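(* Let $T\ge1$, $\sigma_t>0$, $\alpha_t>0$ for $1\le t\le T$, and let $\mathbf C=(C_{tt'})$ be a positive definite $T\times T$ matrix with unit diagonal. Consider the unsupervised multitask Gaussian mixture problem ($\eta_t=0$ for all $t$) with these parameters, with overlaps $(q_{ut},q_{vt})_{t=1}^T$ as defined in the context. If the tasks are connected, then either all tasks are feasible ($q_{ut}>0$ for all $t$) or all tasks are impossible ($q_{ut}=0$ for all $t$).
   Context: Connected tasks. The tasks are connected if for any two tasks $t$ and $t'$ there is a sequence of tasks $t_1,\dots,t_k$ such that $C_{tt_1},C_{t_1t_2},\dots,C_{t_kt'}$ are all nonzero. Overlaps in the unsupervised case. Let $\mathbf M=\big(C_{tt'}/(\sigma_t\sigma_{t'})\big)_{t,t'=1}^T$ and $F(q)=\mathbb E[\tanh(\sqrt q\,Z+q)]$ for $q\ge0$, with $Z\sim\mathcal N(0,1)$. The overlaps $(q_{ut},q_{vt})_{t=1}^T$ (nonnegative numbers) are the stable solution of the fixed-point equations $$q_{ut}=\big[\mathbf M-\mathbf M(\mathbf I+\mathbf D\mathbf M)^{-1}\big]_{tt},\qquad q_{vt}=F(q_{ut}),\qquad 1\le t\le T,$$ where $\mathbf D=\operatorname{diag}(\alpha_tq_{vt})_{t=1}^T$. Here a solution is called stable if it is a (Lyapunov) stable fixed point, on $[0,\infty)^T$, of the iteration $\mathbf q_u\mapsto G(\mathbf q_u)$, $G_t(\mathbf q_u)=[\mathbf M-\mathbf M(\mathbf I+\mathbf D\mathbf M)^{-1}]_{tt}$ with $\mathbf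 D=\operatorname{diag}(\alpha_sF(q_{us}))_{s=1}^T$. The zero vector is always a solution; when there are several solutions the overlaps are, by convention, the stable one. Classification of task $t$ is called impossible if $q_{ut}=0$ and feasible if $q_{ut}>0$. *)

(* Defs.v *)
(* MathComp and MathComp-Analysis; the reals are an arbitrary R : realType. *)
From mathcomp Require Import all_boot all_order all_algebra.
From mathcomp Require Import all_classical all_reals all_analysis.

Set Implicit Arguments.
Unset Strict Implicit.
Unset Printing Implicit Defensive.

Import Order.TTheory GRing.Theory Num.Theory.
Import numFieldNormedType.Exports.

Local Open Scope classical_set_scope.
Local Open Scope ring_scope.

Definition posdefmx (R : realType) (T : nat) (A : 'M[R]_T) : Prop :=
  A^T = A /\ forall x : 'cV[R]_T, x != 0 -> 0 < (x^T *m A *m x) 0 0.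

(* The path from t through the intermediate tasks s to t' has all its
   consecutive coefficients nonzero; s may be empty. *)
Definition connected_tasks (R : realType) (T : nat) (C : 'M[R]_T) : Prop :=
  forall t t' : 'I_T, exists s : seq 'I_T,
    path (fun i j => C i j != 0) t (rcons s t').

Definition tanh (R : realType) (x : R) : R :=
  (expR x - expR (- x)) / (expR x + expR (- x)).

(* E[tanh(sqrt q Z + q)] with Z ~ N(0,1), as an expectation under the law of Z
   (normal_prob takes the mean and the standard deviation).  The integrand is
   bounded, so the expectation is finite and [fine] loses nothing. *)
Definition F (R : realType) (q : R) : R :=
  fine ('E_(normal_prob (0 : R) 1)[fun z : R => tanh (Num.sqrt q * z + q)])%E.

Definition scaled_corr (R : realType) (T : nat) (sigma : 'I_T -> R)
    (C : 'M[R]_T) : 'M[R]_T :=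
  \matrix_(t, t') (C t t' / (sigma t * sigma t')).

(* The diagonal of M - M (I + D M)^-1, D = diag (alpha_t qv_t), as a row vector.
   When M is positive definite and qv, alpha >= 0, the matrix I + D M is
   invertible, so the default value of invmx is not used. *)
Definition qu_of_qv (R : realType) (T : nat) (alpha : 'I_T -> R) (M : 'M[R]_T)
    (qv : 'rV[R]_T) : 'rV[R]_T :=
  let D := diag_mx (\row_t (alpha t * qv 0 t)) in
  \row_t (M - M *m invmx (1%:M + D *m M)) t t.

Definition qv_of_qu (R : realType) (T : nat) (qu : 'rV[R]_T) : 'rV[R]_T :=
  \row_t F (qu 0 t).

Definition G (R : realType) (T : nat) (alpha : 'I_T -> R) (M : 'M[R]_T)
    (qu : 'rV[R]_T) : 'rV[R]_T :=
  qu_of_qv alpha M (qv_of_qu qu).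

Definition nneg_orthant (R : realType) (T : nat) : set 'rV[R]_T :=
  [set q | forall t, 0 <= q 0 t].

(* Lyapunov stability of the fixed point x of the iteration of f on S;
   the norm on 'rV_T is the sup norm. *)
Definition stable_fixed_point (R : realType) (T : nat) (S : set 'rV[R]_T)
    (f : 'rV[R]_T -> 'rV[R]_T) (x : 'rV[R]_T) : Prop :=
  [/\ S x, f x = x &
    forall e : R, 0 < e -> exists2 d : R, 0 < d &
      forall y, S y -> `|y - x| < d -> forall n : nat, `|iter n f y - x| < e].

Definition unsupervised_overlaps (R : realType) (T : nat)
    (sigma alpha : 'I_T -> R) (C : 'M[R]_T) (qu qv : 'rV[R]_T) : Prop :=
  let M := scaled_corr sigma C in
  [/\ nneg_orthant qu /\ nneg_orthant qv,
      forall t, qu 0 t = qu_of_qv alpha M qv 0 t,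
      forall t, qv 0 t = F (qu 0 t) &
      stable_fixed_point (@nneg_orthant R T) (G alpha M) qu].

Definition feasible (R : realType) (T : nat) (qu : 'rV[R]_T) (t : 'I_T) : Prop :=
  0 < qu 0 t.

Definition impossible (R : realType) (T : nat) (qu : 'rV[R]_T) (t : 'I_T) : Prop :=
  qu 0 t = 0.

(* Main.v *)
Require Import Defs.
From mathcomp Require Import all_boot all_order all_algebra.
From mathcomp Require Import all_classical all_reals all_analysis.
From mathcomp Require Import measurable_realfun.
From mathcomp Require Import ring lra.

(** If task [t] has zero overlap, put [w = (1 + D M)^-1 e_t] and [u = M w], so
    that [e_t = w + D u].  By symmetry of [M],
      [0 = M_tt - (M (1 + D M)^-1)_tt = u^T D u + (D u)^T M (D u)],
    and both terms are nonnegative, hence zero.  So [D u = 0], [w = e_t], and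
    [u] is the [t]-th column of [M], which therefore vanishes at each [s] with
    [D_ss > 0].  Since [F q > 0] for [q > 0], a task with zero overlap is
    uncorrelated with every task of positive overlap; by connectedness one of
    the two kinds is absent. *)

Set Implicit Arguments.
Unset Strict Implicit.
Unset Printing Implicit Defensive.

Import Order.TTheory GRing.Theory Num.Theory.
Import numFieldNormedType.Exports.

Local Open Scope classical_set_scope.
Local Open Scope ring_scope.

(** If the integral vanished, [f] would be zero almost everywhere on [D]; as [f] is nowhere zero
    there, [D] would lie in a null set. *)
Lemma integral_gt0 (d : measure_display) (T : measurableType d) (R : realType)
    (mu : {measure set T -> \bar R}) (D : set T) (f : T -> \bar R) :
  measurable D -> measurable_fun D f -> (forall x, D x -> (0 < f x)%E) ->
  (0 < mu D -> 0 < \int[mu]_(x in D) f x)%E.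
Proof.
move=> mD mf f0 muD.
have If0 : (0 <= \int[mu]_(x in D) f x)%E by apply: integral_ge0 => x /f0/ltW.
rewrite lt_neqAle If0 andbT; apply/eqP => I0.
have : (\int[mu]_(x in D) `|f x| = 0)%E.
  by rewrite I0; apply: eq_integral => x /set_mem/f0/ltW/gee0_abs.
move/(ae_eq_integral_abs mu mD mf) => [N [mN N0 DN]].
suff : (mu D <= 0)%E by rewrite leNgt muD.
rewrite -N0; apply: le_measure; rewrite ?inE// => x Dx; apply: DN => /= /(_ Dx).
by move=> fx0; have := f0 x Dx; rewrite fx0 ltxx.
Qed.

Section symmetric_normal.
Context {R : realType}.
Local Open Scope ereal_scope.

Lemma normal_pdfN (s x : R) : s != 0%R ->
  normal_pdf 0 s (- x)%R = normal_pdf 0 s x.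
Proof.
by move=> s0; rewrite /normal_pdf (negbTE s0) /normal_fun !subr0 sqrrN.
Qed.

(** The centred density is even and Lebesgue measure is invariant under negation, so the change of
    variable [x] to [- x] preserves the law. *)
Lemma normal_probN (s : R) (A : set R) : s != 0%R -> measurable A ->
  pushforward (normal_prob 0 s) (-%R : R -> measurableTypeR R) A =
  normal_prob 0 s A.
Proof.
move=> s0 mA; rewrite /pushforward /normal_prob.
have mp : measurable_fun setT (fun x : R => (normal_pdf 0 s x)%:E).
  by apply/measurable_EFinP; exact: measurable_normal_pdf.
transitivity (\int[lebesgue_measure]_(x in
    (-%R : R -> measurableTypeR R) @^-1` A) (normal_pdf 0 s (- x)%R)%:E).
  by apply: eq_integral => x _; rewrite normal_pdfN.
rewrite -(ge0_integral_pushforward (Y := measurableTypeR R) _ _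
  (f := fun x => (normal_pdf 0 s x)%:E))//.
- by apply: eq_measure_integral => B mB _; exact: lebesgue_measureN.
- exact: measurable_funTS.
- by move=> x _; rewrite lee_fin normal_pdf_ge0.
Qed.

Lemma integral_normal_probN (s : R) (f : R -> \bar R) :
  s != 0%R -> measurable_fun setT f ->
  (normal_prob 0 s).-integrable setT (fun x => f (- x)%R) ->
  \int[normal_prob 0 s]_x f (- x)%R = \int[normal_prob 0 s]_x f x.
Proof.
move=> s0 mf fi.
transitivity (\int[pushforward (normal_prob 0 s)
    (-%R : R -> measurableTypeR R)]_x f x).
  by apply/esym/integral_pushforward.
by apply: eq_measure_integral => B mB _; exact: normal_probN.
Qed.

End symmetric_normal.

Section hyperbolic_tangent.
Context {R : realType}.
Implicit Types x y : R.

Let den_gt0 x : 0 < expR x + expR (- x).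
Proof. by rewrite addr_gt0 ?expR_gt0. Qed.

Lemma tanhN x : tanh (- x) = - tanh x.
Proof. by rewrite /tanh opprK -mulNr opprB [expR (- x) + expR x]addrC. Qed.

Lemma ltr_tanh x y : x < y -> tanh x < tanh y.
Proof.
move=> xy; rewrite /tanh ltr_pdivrMr// mulrAC ltr_pdivlMr//.
have h1 : expR x < expR y by rewrite ltr_expR.
have h2 : expR (- y) < expR (- x) by rewrite ltr_expR ltrN2.
have := expR_gt0 x; have := expR_gt0 (- y).
(* Once the denominators are cleared, the two sides of the goal differ by exactly twice this
   quantity. *)
have : 0 < expR y * expR (- x) - expR x * expR (- y).
  by rewrite subr_gt0 ltr_pM ?expR_ge0.
lra.
Qed.

Lemma normr_tanh_le1 x : `|tanh x| <= 1.
Proof.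
rewrite /tanh normrM normfV (gtr0_norm (den_gt0 x)) ler_pdivrMr// mul1r.
by rewrite ler_norml; have := expR_gt0 x; have := expR_gt0 (- x); lra.
Qed.

Lemma continuous_tanh : continuous (@tanh R).
Proof.
move=> x; have cN : expR (- y) @[y --> x] --> expR (- x).
  by apply: continuous_comp; [exact: opp_continuous|exact: continuous_expR].
apply: cvgM; first by apply: cvgB => //; exact: continuous_expR.
apply: cvgV; first by rewrite gt_eqF.
by apply: cvgD => //; exact: continuous_expR.
Qed.

End hyperbolic_tangent.

(* The law of [Z] being symmetric, [2 F q] is the mean of
   [tanh (sqrt q Z + q) - tanh (sqrt q Z - q)], which is positive. *)
Lemma F_gt0 (R : realType) (q : R) : 0 < q -> 0 < F q.
Proof.
move=> q0; rewrite /F unlock.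
set a := Num.sqrt q; set P := normal_prob _ _.
have PT : P setT = 1%E by exact: (probability_setT (normal_prob 0 1)).
pose h (b : R) := fun z : R => (tanh (a * z + b))%:E.
have ch b : continuous (fun z : R => tanh (a * z + b)).
  move=> z; apply: (@continuous_comp _ _ _ (fun z : R => a * z + b)).
    by apply: cvgD; [exact: mulrl_continuous|exact: cvg_cst].
  exact: continuous_tanh.
have mh b : measurable_fun setT (h b).
  by apply/measurable_EFinP; exact: continuous_measurable_fun.
(* A measurable function bounded by 1 is integrable under a probability measure. *)
have ih b : P.-integrable setT (h b).
  apply: (@measurable_bounded_integrable _ _ _ P) => //.
  - by rewrite -[ltLHS]/(P setT) PT ltry.
  - exact: continuous_measurable_fun.
  - exists 1; split => // M M1 z _ /=.
    by rewrite (le_trans (normr_tanh_le1 _)) ?ltW.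
(* Since [tanh] is odd, reflecting [z] turns the shift [q] into [- q], up to an overall sign. *)
have hN z : h q (- z) = (- h (- q)%R z)%E.
  by rewrite /h -EFinN -tanhN; congr (tanh _)%:E; ring.
have ihN : P.-integrable setT (fun z => h q (- z)).
  by apply: (eq_integrable _ _ _ _ (integrableN (ih (- q)))).
have : (0 < \int[P]_z (h q z + h q (- z)%R))%E.
  apply: integral_gt0 => //; last by rewrite -[ltRHS]/(P setT) PT lte01.
    by apply: emeasurable_funD; [case/integrableP: (ih q)|case/integrableP: ihN].
  move=> z _; rewrite hN /h -EFinB lte_fin subr_gt0 ltr_tanh//; lra.
rewrite integralD// (integral_normal_probN (oner_neq0 R) (mh q) ihN).
have fin := integrable_fin_num measurableT (ih q).
(* Both integrals are now the same finite number, so the inequality says that its double is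
   positive. *)
rewrite -[(\int[P]_z _)%E]fineK// -EFinD lte_fin => h2.
suff : 0 < fine (\int[P]_z h q z)%E by [].
lra.
Qed.

Section posdef.
Context {R : realType} {T : nat}.
Implicit Types (M C : 'M[R]_T) (d : 'rV[R]_T) (x : 'cV[R]_T).

Lemma posdefmx_ge0 M x : posdefmx M -> 0 <= (x^T *m M *m x) 0 0.
Proof.
move=> [_ M0]; have [->|/M0/ltW//] := eqVneq x 0.
by rewrite mulmx0 mxE.
Qed.

Lemma posdefmx_eq0 M x : posdefmx M -> (x^T *m M *m x) 0 0 <= 0 -> x = 0.
Proof. by move=> [_ M0] xM; have [//|/M0] := eqVneq x 0; rewrite ltNge xM. Qed.

Lemma quad_diag_mx d x :
  (x^T *m diag_mx d *m x) 0 0 = \sum_i d 0 i * x i 0 ^+ 2.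
Proof.
rewrite mxE; apply: eq_bigr => i _.
by rewrite mul_mx_diag !mxE; ring.
Qed.

Lemma quad_diag_mx_ge0 d x : (forall i, 0 <= d 0 i) ->
  0 <= (x^T *m diag_mx d *m x) 0 0.
Proof.
by move=> d0; rewrite quad_diag_mx sumr_ge0// => i _; rewrite mulr_ge0 ?sqr_ge0.
Qed.

(** The scaling is the congruence [S *m C *m S] by an invertible diagonal matrix, and congruence
    preserves positive definiteness. *)
Lemma posdefmx_scaled_corr (sigma : 'I_T -> R) C :
  (forall t, 0 < sigma t) -> posdefmx C -> posdefmx (scaled_corr sigma C).
Proof.
move=> s0 [CT C0]; pose S := diag_mx (\row_t (sigma t)^-1).
have -> : scaled_corr sigma C = S *m C *m S.
  apply/matrixP => i j; rewrite mul_mx_diag mul_diag_mx !mxE invfM; ring.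
split; first by rewrite !trmx_mul tr_diag_mx CT mulmxA.
move=> x x0; have Sx0 : S *m x != 0.
  apply: contra_neq x0 => Sx; apply/colP => i.
  move/colP/(_ i): Sx; rewrite mul_diag_mx !mxE => /eqP.
  by rewrite mulf_eq0 invr_eq0 gt_eqF//= => /eqP.
by have := C0 _ Sx0; rewrite trmx_mul tr_diag_mx !mulmxA.
Qed.

(** If [x] is in the kernel, then [x = - D M x], so [x^T M x = - (M x)^T D (M x) <= 0] and
    [x = 0]. *)
Lemma unitmx_1DM M d : posdefmx M -> (forall i, 0 <= d 0 i) ->
  1%:M + diag_mx d *m M \in unitmx.
Proof.
(* Row freeness concerns the left kernel; passing to the transpose makes it the kernel on
   columns. *)
move=> pM d0; rewrite -unitmx_tr -row_free_unit; apply/inj_row_free => v.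
move=> /(congr1 trmx); rewrite trmx_mul trmxK trmx0 mulmxDl mul1mx.
set x := v^T => /eqP; rewrite addr_eq0 -mulmxA => /eqP xE.
suff x0 : x = 0 by rewrite -[v]trmxK -/x x0 trmx0.
idtac; apply: (posdefmx_eq0 pM); rewrite -mulmxA {1}xE linearN/= mulNmx mxE oppr_le0.
rewrite trmx_mul tr_diag_mx; exact: quad_diag_mx_ge0.
Qed.

Lemma qu_of_qv_eq0 (alpha : 'I_T -> R) M (qv : 'rV[R]_T) (t s : 'I_T) :
  posdefmx M -> (forall i, 0 < alpha i) -> (forall i, 0 <= qv 0 i) ->
  qu_of_qv alpha M qv 0 t = 0 -> 0 < qv 0 s -> M s t = 0.
Proof.
move=> pM a0 qv0; rewrite /qu_of_qv mxE.
set d := \row_i (alpha i * qv 0 i); set D := diag_mx d => Bt qvs.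
have d0 i : 0 <= d 0 i by rewrite mxE mulr_ge0 ?qv0 ?ltW.
have MT : M^T = M by case: pM.
pose e : 'cV[R]_T := delta_mx t 0.
have entry (A : 'M[R]_T) : A t t = (e^T *m A *m e) 0 0.
  by rewrite /e trmx_delta -rowE -colE !mxE.
pose w := invmx (1%:M + D *m M) *m e; pose u := M *m w.
have eE : e = w + D *m u.
  by rewrite /u mulmxA -[X in X + _]mul1mx -mulmxDl mulKVmx// unitmx_1DM.
have DuE : D *m u = e - w by rewrite eE addrC addKr.
have quadE : (u^T *m D *m u) 0 0 + ((D *m u)^T *m M *m (D *m u)) 0 0 = 0.
  (* Applied to [e], the matrix [M - M (1 + D M)^-1] gives [M (e - w) = M (D u)]. *)
  have {}Bt : (e^T *m M *m (D *m u)) 0 0 = 0.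
    rewrite -Bt entry; congr (_ 0 0).
    rewrite mulmxBr mulmxBl -[X in _ - X]mulmxA -[X in _ - _ *m X]mulmxA.
    by rewrite -/w [X in _ - X]mulmxA -mulmxBr DuE.
  (* Splitting the left factor [e] as [w + D u] yields both terms, because [w^T M = u^T] by symmetry
     of [M]. *)
  rewrite -[RHS]Bt [e]eE linearD/= !mulmxDl [RHS]mxE; congr (_ + _); congr (_ 0 0).
  by rewrite [in LHS]/u trmx_mul MT !mulmxA.
have h1 := quad_diag_mx_ge0 u d0; have h2 := posdefmx_ge0 (D *m u) pM.
have Du0 : D *m u = 0 by apply: (posdefmx_eq0 pM); rewrite -/D in h1; lra.
have uE : u = M *m e by rewrite eE Du0 addr0.
have : (D *m u) s 0 = 0 by rewrite Du0 mxE.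
(* The entry at [s] reads [alpha s * qv 0 s * M s t = 0], and its first two factors are positive. *)
rewrite mul_diag_mx uE -colE !mxE => /eqP.
by rewrite !mulf_eq0 (gt_eqF (a0 s)) (gt_eqF qvs) => /eqP.
Qed.
End posdef.

Theorem mainTheorem6 (R : realType) (T : nat) (hT : (1 <= T)%N)
    (sigma alpha : 'I_T -> R) (C : 'M[R]_T) (qu qv : 'rV[R]_T)
    (hsigma : forall t, 0 < sigma t) (halpha : forall t, 0 < alpha t)
    (hC : posdefmx C) (hdiag : forall t, C t t = 1)
    (hq : unsupervised_overlaps sigma alpha C qu qv)
    (hconn : connected_tasks C) :
  (forall t, feasible qu t) \/ (forall t, impossible qu t).
Proof.
case: hq => -[qu0 qv0] quE qvE _.
have step (i j : 'I_T) : C i j != 0 -> qu 0 i = 0 -> qu 0 j = 0.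
  move=> Cij qui; apply/eqP; apply: contraNT Cij => quj.
  have quj0 : 0 < qu 0 j by rewrite lt_def quj qu0.
  have qvj0 : 0 < qv 0 j by rewrite qvE F_gt0.
  have pM := posdefmx_scaled_corr hsigma hC.
  have := qu_of_qv_eq0 (t := i) pM halpha qv0 _ qvj0.
  (* The vanishing entry of [M] is [C j i] over nonzero deviations; symmetry of [C] turns it into
     [C i j]. *)
  rewrite -quE => /(_ qui) /eqP; rewrite mxE mulf_eq0 invr_eq0 mulf_eq0.
  by rewrite !(gt_eqF (hsigma _)) !orbF -[in X in X -> _](proj1 hC) mxE.
have walk (s : seq 'I_T) (t t' : 'I_T) :
    path (fun i j => C i j != 0) t (rcons s t') -> qu 0 t = 0 -> qu 0 t' = 0.
  by elim: s t => [|r s IHs] t /= /andP[/step tr]; [|move/IHs] => // + /tr; apply.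
(* A single zero overlap reaches every task along a connecting path; if there is none, nonnegativity
   makes all overlaps positive. *)
have [[t qut]|all_pos] := pselect (exists t, qu 0 t = 0); [right|left] => t'.
  by have [s /walk] := hconn t t'; apply.
rewrite /feasible lt_def qu0 andbT; apply/eqP => qut'.
by apply: all_pos; exists t'.
Qed.
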